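(* Let $G=(V,E)$ be a connected graph. The following statements are equivalent: (i) $G$ is a partial cube. (ii) $G$ is bipartite and, for any $ab\in E$ and any $xy,uv\in F_{ab}$ with $x,u\in W_{ab}$ and $y,v\in W_{ba}$, $$d(x,u)=d(y,v)\quad\text{and}\quad d(x,v)=d(y,u).$$
   Context: Graphs are simple, undirected, nonempty, and not necessarily finite; $d$ denotes the shortest-path distance in $G$. For a set $X$, the hypercube $\mathcal H(X)$ is the graph whose vertices are the finite subsets of $X$, with $P,Q$ adjacent iff $|P\Delta Q|=1$. A graph is a partial cube if it can be isometrically embedded (i.e. by a map preserving shortest-path distances) into $\mathcal H(X)$ for some set $X$. For adjacent $a,b\in V$, $W_{ab}=\{w\in V: d(w,a)<d(w,b)\}$, and $F_{ab}=\{uv\in E: u\in W_{ab},\ v\in W_{ba}\}$. *)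

(* Defs.v *)
From HB Require Import structures.
From mathcomp Require Import all_boot finmap.
From mathcomp Require Import boolp classical_sets.

Set Implicit Arguments.
Unset Strict Implicit.
Unset Printing Implicit Defensive.

Local Open Scope classical_set_scope.

(* The vertex type is arbitrary, possibly infinite. *)
Record sgraph := SGraph {
  vertex :> Type;
  adj : rel vertex;
  adj_sym : symmetric adj;
  adj_irrefl : irreflexive adj;
  vertex_inhabited : inhabited vertex
}.

Section Metric.
Variable G : sgraph.

Definition walk_length (x y : G) : set nat :=
  [set n | exists p : seq G, [/\ path (@adj G) x p, last x p = y & size p = n]].

Definition linked (x y : G) : Prop := exists n, walk_length x y n.

Definition connected : Prop := forall x y : G, linked x y.

(* Walks may repeat vertices, which does not affect the minimal length.
   The value is 0 when x and y lie in different components. *)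
Definition dist (x y : G) : nat :=
  xget 0 [set n | walk_length x y n /\
                  forall m, walk_length x y m -> n <= m].

Definition bipartite : Prop :=
  exists c : G -> bool, forall x y : G, adj x y -> c x != c y.

Definition W (a b : G) : set G := [set w | dist w a < dist w b].

(* An undirected edge uv is the set [set u; v]. *)
Definition F (a b : G) : set (set G) :=
  [set e | exists u v : G, [/\ adj u v, W a b u, W b a v & e = [set u; v]]].

End Metric.

(* As dist is 0 across components, finiteness of the distance has to be
   preserved separately. *)
Definition isometric (G H : sgraph) (f : G -> H) : Prop :=
  forall x y : G, (linked (f x) (f y) <-> linked x y) /\
                  dist (f x) (f y) = dist x y.

Section Hypercube.
Variable X : choiceType.

Definition symdiff (P Q : {fset X}) : {fset X} :=
  ((P `\` Q) `|` (Q `\` P))%fset.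

Definition hypercube_adj : rel {fset X} := fun P Q => #|` symdiff P Q| == 1.

Fact hypercube_adj_sym : symmetric hypercube_adj.
Proof. by move=> P Q; rewrite /hypercube_adj /symdiff fsetUC. Qed.

Fact hypercube_adj_irrefl : irreflexive hypercube_adj.
Proof.
by move=> P; rewrite /hypercube_adj /symdiff fsetUid fsetDv cardfs0.
Qed.

Definition hypercube : sgraph :=
  SGraph hypercube_adj_sym hypercube_adj_irrefl (inhabits fset0).

End Hypercube.

(* Classically every type carries a choiceType structure, so X ranges over
   arbitrary sets. *)
Definition partial_cube (G : sgraph) : Prop :=
  exists (X : choiceType) (f : G -> hypercube X), isometric f.

(* Main.v *)
(** If an isometry into a hypercube sends the ends of an edge [ab] to sets
    differing exactly at [z], then [W_ab] is the set of vertices agreeing with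
    [a] at [z], and every edge of [F_ab] toggles [z]; this gives (ii).

    Conversely, (ii) forces [W_ab = W_xy] for every edge [xy] of [F_ab] with
    [x] in [W_ab]: if [w] in [W_ab] were closer to [y] than to [x], a geodesic
    from [w] to [y] would cross [F_ab] at an edge [uv], and
    [d(u,x) = d(v,y)] would give a shorter walk from [w] to [x].
    Fix a base vertex [r] and send [w] to the set of halfspaces [W_ab] that
    contain [w] but not [r].  By the above, moving along an edge toggles exactly
    one halfspace, and along a geodesic no halfspace is toggled twice. *)

Require Import Defs.
From HB Require Import structures.
From mathcomp Require Import all_boot finmap.
From mathcomp Require Import boolp classical_sets.
From mathcomp Require Import zify.

Set Implicit Arguments.
Unset Strict Implicit.
Unset Printing Implicit Defensive.

Local Open Scope classical_set_scope.

(** * Walks and distances in a connected graph *)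

Section Distance.
Variable G : sgraph.
Implicit Types x y z w : G.

Lemma dist_unique x y n : walk_length x y n ->
  (forall m, walk_length x y m -> n <= m) -> dist x y = n.
Proof.
move=> hn hmin; rewrite /dist.
case: xgetP => [m _ [hm hle]|/(_ n)]; last by case.
by apply/eqP; rewrite eqn_leq hmin // hle.
Qed.

Lemma dist_spec x y : linked x y -> walk_length x y (dist x y) /\
  forall m, walk_length x y m -> dist x y <= m.
Proof.
case=> n hn.
have hex : exists m, `[< walk_length x y m >] by exists n; apply/asboolP.
case: (ex_minnP hex) => m /asboolP hm hle.
have hle' k : walk_length x y k -> m <= k by move=> hk; apply/hle/asboolP.
by rewrite (dist_unique hm hle').
Qed.

Lemma walk_length0 x : walk_length x x 0.
Proof. by exists [::]. Qed.

Lemma walk_length0_eq x y : walk_length x y 0 -> x = y.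
Proof. by case=> -[|z p] []. Qed.

Lemma walk_length_cons x z y n :
  adj x z -> walk_length z y n -> walk_length x y n.+1.
Proof. by move=> xz [p [hp <- <-]]; exists (z :: p); rewrite /= xz. Qed.

Lemma walk_lengthS x y n : walk_length x y n.+1 ->
  exists z, adj x z /\ walk_length z y n.
Proof.
case=> -[|z p] [] //= /andP[xz hp] hl [hs].
by exists z; split=> //; exists p.
Qed.

Lemma walk_length_cat x z y m n :
  walk_length x z m -> walk_length z y n -> walk_length x y (m + n).
Proof.
elim: m x => [|m IH] x.
  by move/walk_length0_eq->.
move=> /walk_lengthS[t [xt ht]] hn.
exact: walk_length_cons xt (IH _ ht hn).
Qed.

Lemma walk_length_sym x y n : walk_length x y n -> walk_length y x n.
Proof.
elim: n x => [|n IH] x; first by move/walk_length0_eq->; exact: walk_length0.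
move=> /walk_lengthS[z [xz /IH hz]]; rewrite -addn1.
apply: walk_length_cat hz _.
by apply: (@walk_length_cons _ x); [rewrite adj_sym|exact: walk_length0].
Qed.

Lemma walk_length_odd (c : G -> bool) x y n :
  (forall x y, adj x y -> c x != c y) ->
  walk_length x y n -> odd n = c x (+) c y.
Proof.
move=> hc; elim: n x => [|n IH] x.
  by move/walk_length0_eq->; rewrite addbb.
move=> /walk_lengthS[z [/hc + /IH /= ->]].
by case: (c x) (c z) (c y) => [] [] [].
Qed.

Hypothesis hG : connected G.

Lemma dist_walk x y : walk_length x y (dist x y).
Proof. by case: (dist_spec (hG x y)). Qed.

Lemma dist_le x y n : walk_length x y n -> dist x y <= n.
Proof. by case: (dist_spec (hG x y)) => _; apply. Qed.

Lemma dist_triangle x y z : dist x z <= dist x y + dist y z.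
Proof. exact/dist_le/walk_length_cat/dist_walk/dist_walk. Qed.

Lemma dist_sym x y : dist x y = dist y x.
Proof.
by apply/eqP; rewrite eqn_leq !dist_le //; exact/walk_length_sym/dist_walk.
Qed.

Lemma distxx x : dist x x = 0.
Proof. by apply/eqP; rewrite -leqn0; exact/dist_le/walk_length0. Qed.

Lemma dist_eq0 x y : dist x y = 0 -> x = y.
Proof. by move=> h; have := dist_walk x y; rewrite h => /walk_length0_eq. Qed.

Lemma dist_adj x y : adj x y <-> dist x y = 1.
Proof.
split=> [xy|h]; last first.
  have := dist_walk x y; rewrite h => /walk_lengthS[z [xz]].
  by move/walk_length0_eq<-.
have : dist x y <= 1 by exact/dist_le/(walk_length_cons xy)/walk_length0.
case E: (dist x y) => [|[|]] // _.
by move: xy; rewrite (dist_eq0 E) adj_irrefl.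
Qed.

Lemma dist_pred x y n : dist x y = n.+1 ->
  exists z, adj z y /\ dist x z = n.
Proof.
move=> h; have := dist_walk x y; rewrite h => /walk_length_sym.
move=> /walk_lengthS[z [yz hz]]; rewrite adj_sym in yz; exists z; split=> //.
have /dist_adj := yz; have := dist_triangle x z y.
by have := dist_le (walk_length_sym hz); lia.
Qed.

(** Step back from [y] along a geodesic from [w]: either the preceding vertex lies in [A] and the
    last edge crosses, or induction applies to that vertex. The distance equation places the
    crossing edge on a geodesic. *)
Lemma geodesic_crossing (A : set G) w y : A w -> ~ A y ->
  exists u v, [/\ adj u v, A u, ~ A v & dist w y = dist w u + 1 + dist v y].
Proof.
move=> Aw; move E: (dist w y) => n; elim: n y E => [|n IH] y E nAy.
  by rewrite (dist_eq0 E) in Aw.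
have [z [zy hz]] := dist_pred E.
have [Az|nAz] := pselect (A z).
  by exists z, y; split=> //; rewrite distxx hz; lia.
have [u [v [uv Au nAv hn]]] := IH _ hz nAz.
exists u, v; split=> //.
have := dist_triangle w u y; have := dist_triangle u v y.
by have := dist_triangle v z y; move/dist_adj: uv; move/dist_adj: zy; lia.
Qed.

(** Equal distances would give walks of the same parity from [w] to [a] and to [b], hence the same
    colour at both ends of an edge. *)
Lemma bipartite_dist_neq : bipartite G ->
  forall w a b, adj a b -> dist w a <> dist w b.
Proof.
move=> [c hc] w a b ab h.
have := walk_length_odd hc (dist_walk w a).
have := walk_length_odd hc (dist_walk w b).
by rewrite h => ->; have := hc _ _ ab; case: (c a) (c b) (c w) => [] [] [].
Qed.

Lemma W_adj (a b : G) : adj a b -> W a b a.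
Proof. by move=> /dist_adj ab1; change (dist a a < dist a b); rewrite distxx ab1. Qed.

End Distance.

Lemma addb_eq_iff (T : eqType) (b : bool) (s t : T) :
  (b (+) (s == t)) <-> (b <-> s <> t).
Proof.
have tt : true by []. have ff : ~ false by [].
by case: b; case: eqP => st /=; tauto.
Qed.

(** * Distance in the hypercube is the size of the symmetric difference *)

Section CubeDistance.
Variable X : choiceType.
Implicit Types P Q R : {fset X}.

Lemma in_symdiff P Q t : (t \in symdiff P Q) = (t \in P) (+) (t \in Q).
Proof. by rewrite !inE; case: (t \in P); case: (t \in Q). Qed.

Lemma symdiffC P Q : symdiff P Q = symdiff Q P.
Proof. by apply/fsetP => t; rewrite !in_symdiff addbC. Qed.

Lemma cardfs_symdiff1 P Q : #|` symdiff P Q| = 1 ->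
  exists z, forall t, (t \in Q) = (t \in P) (+) (t == z).
Proof.
move=> /eqP/cardfs1P[z hz]; exists z => t.
move/fsetP/(_ t): hz; rewrite in_symdiff inE.
by case: (t == z); case: (t \in P); case: (t \in Q).
Qed.

Lemma cardfs_symdiff_toggle R P Q z :
  (forall t, (t \in Q) = (t \in P) (+) (t == z)) ->
  (z \in R) = (z \in P) -> #|` symdiff R Q| = #|` symdiff R P|.+1.
Proof.
move=> hQ hz.
suff -> : symdiff R Q = (z |` symdiff R P)%fset.
  by rewrite cardfsU1 in_symdiff hz addbb.
apply/fsetP => t; rewrite in_fset1U !in_symdiff hQ.
case: (eqVneq t z) => [->|_] /=; first by rewrite hz; case: (z \in P).
by rewrite addbF.
Qed.

(** This describes the halfspaces of a hypercube: for the edge [P], [Q] in direction [z], the side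
    of [P] is fixed by membership of [z] alone. *)
Lemma cardfs_symdiff_lt R P Q z :
  (forall t, (t \in Q) = (t \in P) (+) (t == z)) ->
  (#|` symdiff R P| < #|` symdiff R Q|) = ((z \in R) == (z \in P)).
Proof.
move=> hQ; case: (eqVneq (z \in R) (z \in P)) => [h|h].
  by rewrite (cardfs_symdiff_toggle hQ h) ltnSn.
have hP t : (t \in P) = (t \in Q) (+) (t == z).
  by rewrite hQ addbK.
have hz : (z \in R) = (z \in Q).
  by move: h; rewrite hQ eqxx; case: (z \in R); case: (z \in P).
by rewrite (cardfs_symdiff_toggle hP hz) ltnNge leqnSn.
Qed.

Lemma cardfs_symdiff_triangle P Q R :
  #|` symdiff P R| <= #|` symdiff P Q| + #|` symdiff Q R|.
Proof.
apply: leq_trans (leq_card_fsetU _ _).1; apply/fsubset_leq_card/fsubsetP => t.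
rewrite in_fsetU !in_symdiff.
by case: (t \in P); case: (t \in Q); case: (t \in R).
Qed.

Lemma cube_walk P Q : @walk_length (hypercube X) P Q #|` symdiff P Q|.
Proof.
move E: #|` symdiff P Q| => n; elim: n P E => [|n IH] P E.
  suff -> : P = Q by exact: walk_length0.
  move/eqP: E; rewrite cardfs_eq0 => /eqP/fsetP E; apply/fsetP => t.
  by move: (E t); rewrite in_symdiff inE; case: (t \in P); case: (t \in Q).
have /fset0Pn[z hz] : symdiff P Q != fset0 by rewrite -cardfs_gt0 E.
have hP' t : (t \in symdiff P [fset z]%fset) = (t \in P) (+) (t == z).
  by rewrite in_symdiff inE.
have hP t : (t \in P) = (t \in symdiff P [fset z]%fset) (+) (t == z).
  by rewrite hP' addbK.
(* Toggling an element [z] on which [P] and [Q] differ is one step towards [Q]. *)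
apply: (@walk_length_cons (hypercube X) P (symdiff P [fset z]%fset)).
  rewrite /= /hypercube_adj (cardfs_symdiff_toggle hP') //.
  rewrite eqSS cardfs_eq0; apply/eqP/fsetP => t.
  by rewrite in_symdiff addbb inE.
apply: IH; move: E; rewrite symdiffC (cardfs_symdiff_toggle hP).
  by rewrite symdiffC => -[].
by move: hz; rewrite in_symdiff hP' eqxx; case: (z \in P); case: (z \in Q).
Qed.

Lemma cube_dist (P Q : hypercube X) : dist P Q = #|` symdiff P Q|.
Proof.
apply: dist_unique; first exact: cube_walk.
move=> m; elim: m P => [|m IH] P.
  move/walk_length0_eq->; rewrite leqn0 cardfs_eq0.
  by apply/eqP/fsetP => t; rewrite in_symdiff addbb inE.
move=> /walk_lengthS[R [/eqP PR /IH hR]].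
by have := cardfs_symdiff_triangle P R Q; rewrite PR; lia.
Qed.

End CubeDistance.

(** * Partial cubes satisfy (ii) *)

(** Since [W a b] and [W b a] are disjoint, an unordered edge of [F a b] can be oriented in only one
    way. *)
Lemma F_adj (G : sgraph) (a b x y : G) :
  F a b [set x; y] -> W a b x -> W b a y -> adj x y.
Proof.
move=> [u [v [uv Wu Wv e]]] Wx Wy.
have hu : [set x; y] u by rewrite e; left.
have hv : [set x; y] v by rewrite e; right.
have disj w : W a b w -> W b a w -> False.
  by move=> h /(ltn_trans h); rewrite ltnn.
case: hu hv uv Wu Wv => -> [] -> uv Wu Wv.
- by case: (disj x).
- by [].
- by rewrite adj_sym.
- by case: (disj y).
Qed.

(** Both graphs are connected, so the clause of [isometric] about [linked] holds automatically. *)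
Lemma cube_isometric (G : sgraph) (X : choiceType) (f : G -> hypercube X) :
  connected G ->
  isometric f <-> forall x y, #|` symdiff (f x) (f y)| = dist x y.
Proof.
move=> hG; split=> [hf x y|hf x y]; first by rewrite -cube_dist; case: (hf x y).
rewrite cube_dist hf; split=> //; split=> // _.
by exists #|` symdiff (f x) (f y)|; exact: cube_walk.
Qed.

Lemma partial_cube_bipartite (G : sgraph) :
  connected G -> partial_cube G -> bipartite G.
Proof.
move=> hG [X [f /(cube_isometric _ hG) hf]].
(* Colour by parity of cardinality: an edge toggles one element. *)
exists (fun w => odd #|` f w|) => x y /(dist_adj hG); rewrite -hf.
move=> /cardfs_symdiff1[z hz].
have e0 (P : {fset X}) : symdiff fset0 P = P.
  by apply/fsetP => t; rewrite in_symdiff inE.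
have hz' t : (t \in f x) = (t \in f y) (+) (t == z).
  by rewrite hz addbK.
case: (boolP (z \in f x)) => zx.
  have := cardfs_symdiff_toggle (R := fset0) hz'.
  by rewrite !e0 inE hz zx eqxx => -> //=; case: (odd _).
have := cardfs_symdiff_toggle (R := fset0) hz.
by rewrite !e0 inE (negbTE zx) => -> //=; case: (odd _).
Qed.

Lemma partial_cube_dist (G : sgraph) : connected G -> partial_cube G ->
  forall a b x y u v : G, adj a b -> adj x y -> adj u v ->
    W a b x -> W a b u -> W b a y -> W b a v ->
    dist x u = dist y v /\ dist x v = dist y u.
Proof.
move=> hG [X [f /(cube_isometric _ hG) hf]] a b x y u v.
move=> /(dist_adj hG) + /(dist_adj hG) + /(dist_adj hG).
rewrite -!hf => /cardfs_symdiff1[z hz].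
move=> /cardfs_symdiff1[s hs] /cardfs_symdiff1[t ht].
have hz' k : (k \in f a) = (k \in f b) (+) (k == z).
  by rewrite hz addbK.
have Wab w : W a b w -> (z \in f w) = (z \in f a).
  change (dist w a < dist w b -> (z \in f w) = (z \in f a)).
  by rewrite -!hf (cardfs_symdiff_lt _ hz) => /eqP.
have Wba w : W b a w -> (z \in f w) = ~~ (z \in f a).
  change (dist w b < dist w a -> (z \in f w) = ~~ (z \in f a)).
  by rewrite -!hf (cardfs_symdiff_lt _ hz') => /eqP ->; rewrite hz eqxx addbT.
move=> /Wab Wx /Wab Wu /Wba Wy /Wba Wv.
(* Membership of [z] changes from [x] to [y], while that edge toggles only [s]; likewise for [t] on
   the other edge. The common toggle then cancels in the symmetric differences. *)
have sz : z = s.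
  by apply/eqP; move: Wy; rewrite hs Wx; case: (z == s); case: (z \in f a).
have tz : z = t.
  by apply/eqP; move: Wv; rewrite ht Wu; case: (z == t); case: (z \in f a).
split; congr #|` _|; apply/fsetP => k; rewrite !in_symdiff hs ht.
  rewrite -sz -tz.
  by case: (k == z); case: (k \in f x); case: (k \in f u).
rewrite -sz -tz.
by case: (k == z); case: (k \in f x); case: (k \in f u).
Qed.

(** * Embedding by halfspaces *)

Section Halfspaces.
Variable G : sgraph.
Hypothesis hG : connected G.
Hypothesis bipG : bipartite G.
Hypothesis crossing_dist : forall a b x y u v : G,
  adj a b -> adj x y -> adj u v ->
  W a b x -> W a b u -> W b a y -> W b a v -> dist x u = dist y v.

Lemma WC (a b w : G) : adj a b -> W b a w <-> ~ W a b w.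
Proof.
move=> ab; have h := bipartite_dist_neq hG bipG (w := w) ab.
change (dist w b < dist w a <-> ~ dist w a < dist w b); lia.
Qed.

Lemma sub_W (a b x y : G) : adj a b -> adj x y -> W a b x -> W b a y ->
  W a b `<=` W x y.
Proof.
move=> ab xy Wx Wy w Ww.
have yx : adj y x by rewrite adj_sym.
have nWy : ~ W a b y by exact/(WC _ ab).
apply/(WC _ yx).
(* The resulting bound is [dist w x <= dist w u + dist v y], which is [dist w y - 1]. *)
have [u [v [uv Wu /(WC _ ab) Wv hw]]] := geodesic_crossing hG Ww nWy.
have := crossing_dist ab xy uv Wx Wu Wy Wv.
have := dist_triangle hG w u x; rewrite (dist_sym hG u x) (dist_sym hG y v).
change (dist w x <= dist w u + dist x u -> dist x u = dist v y ->
  ~ dist w y < dist w x); lia.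
Qed.

Lemma W_eq (a b x y : G) : adj a b -> adj x y -> W a b x -> W b a y ->
  W a b = W x y.
Proof.
move=> ab xy Wx Wy; apply/seteqP; split; first exact: sub_W.
have ba : adj b a by rewrite adj_sym.
have yx : adj y x by rewrite adj_sym.
(* Taking complements, the reverse inclusion is [sub_W] for the reversed edges. *)
by move=> w /(WC _ yx) + ; apply: contra_notP => /(WC _ ab); exact: sub_W.
Qed.

Variable r : G.

(** Excluding halfspaces around [r] leaves those separating [w] from [r], which are finitely many
    even when [G] is infinite. *)
Definition halfspaces (w : G) : set (set G) :=
  [set S | (exists a b, adj a b /\ S = W a b) /\ S w /\ ~ S r].

Lemma halfspaces_sep (x y : G) T : adj x y ->
  halfspaces x T -> ~ halfspaces y T -> T = W x y.
Proof.
move=> xy [[a [b [ab ->]]] [Wx nWr]] nhy; apply: W_eq => //.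
by apply/(WC _ ab) => Wy; apply: nhy; split=> //; exists a, b.
Qed.

Lemma halfspaces_adj (x y : G) : adj x y -> exists S,
  (S = W x y \/ S = W y x) /\
  forall T, halfspaces y T <-> (halfspaces x T <-> T <> S).
Proof.
move=> xy; have yx : adj y x by rewrite adj_sym.
have Wxx := W_adj hG xy; have Wyy := W_adj hG yx.
have nWxy := (WC _ xy).1 Wyy; have nWyx := (WC _ yx).1 Wxx.
(* Of the two halfspaces of an edge, exactly one avoids the base vertex. *)
have [Wr|nWr] := pselect (W x y r).
  have hy : halfspaces y (W y x).
    by split; [exists y, x|split=> //; exact/(WC _ yx)].
  have hx : ~ halfspaces x (W y x) by case=> _ [].
  exists (W y x); split; [by right|move=> T].
  have [->|nT] := pselect (T = W y x); first by tauto.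
  have h1 := @halfspaces_sep y x T yx.
  have [hxT|nxT] := pselect (halfspaces x T); last by tauto.
  have [|nyT] := pselect (halfspaces y T); first by tauto.
  (* A halfspace lost from [x] to [y] would be [W x y], which contains [r]. *)
  by have E := halfspaces_sep xy hxT nyT; case: hxT => _ [_]; rewrite E.
have hx : halfspaces x (W x y) by split; [exists x, y|].
have hy : ~ halfspaces y (W x y) by case=> _ [].
exists (W x y); split; [by left|move=> T].
have [->|nT] := pselect (T = W x y); first by tauto.
have h1 := @halfspaces_sep x y T xy.
have [hyT|nyT] := pselect (halfspaces y T); last by tauto.
have [|nxT] := pselect (halfspaces x T); first by tauto.
have E := halfspaces_sep yx hyT nxT; case: hyT => _ [_]; rewrite E => nr.
by case: nWr; apply/(WC _ yx).
Qed.

Local Notation X := {classic (set G)}.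

(** Induct along a walk from [w] to [r]: no halfspace is attached to [r], and each edge toggles
    one. *)
Lemma halfspaces_finite (w : G) :
  exists P : {fset X}, forall S : X, S \in P <-> halfspaces w S.
Proof.
have [n /(walk_length_sym)] := hG r w; elim: n w => [|n IH] w.
  move=> /walk_length0_eq ->; exists fset0 => S; rewrite inE.
  by split=> // -[_ []].
move=> /walk_lengthS[z [wz /IH[P hP]]].
have [|S [_ hS]] := @halfspaces_adj z w; first by rewrite adj_sym.
exists (symdiff P [fset (S : X)]%fset) => T; rewrite hS -hP in_symdiff inE.
exact: addb_eq_iff.
Qed.

Lemma halfspaces_partial_cube : partial_cube G.
Proof.
have [f hf] := choice halfspaces_finite.
exists X, f; apply/(cube_isometric _ hG) => u v.
move E: (dist u v) => n; elim: n v E => [|n IH] v E.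
  rewrite (dist_eq0 hG E); apply/eqP; rewrite cardfs_eq0.
  by apply/eqP/fsetP => t; rewrite in_symdiff addbb inE.
have [z [zv hz]] := dist_pred hG E; rewrite -(IH _ hz).
have [S [SW hS]] := halfspaces_adj zv.
apply: (@cardfs_symdiff_toggle _ _ _ _ (S : X)).
  by move=> T; apply/idP/idP; rewrite hf hS -hf => /addb_eq_iff.
have vz : adj v z by rewrite adj_sym.
(* As [z] precedes [v] on a geodesic from [u], the vertices [u] and [z] lie on the same side of the
   edge [zv]. Their images agree at [S], so toggling [S] adds one to the size of the symmetric
   difference. *)
have Wu : W z v u by change (dist u z < dist u v); rewrite hz E.
have Wz := W_adj hG zv.
have Suz : S u <-> S z.
  case: SW => ->; first by tauto.
  by rewrite !(WC _ zv); tauto.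
by apply/idP/idP => /hf[hS1 [hS2 hS3]]; apply/hf; split=> //; split=> //;
  apply/Suz.
Qed.

End Halfspaces.

Theorem theorem4p2 (G : sgraph) (hG : connected G) :
  partial_cube G <->
  bipartite G /\
  forall a b : G, adj a b ->
  forall x y u v : G,
    F a b [set x; y] -> F a b [set u; v] ->
    W a b x -> W a b u -> W b a y -> W b a v ->
    dist x u = dist y v /\ dist x v = dist y u.
Proof.
split=> [pc|[bipG hF]].
  split; first exact: partial_cube_bipartite.
  move=> a b ab x y u v hxy huv Wx Wu Wy Wv.
  exact: (partial_cube_dist hG pc ab (F_adj hxy Wx Wy) (F_adj huv Wu Wv)).
have [r] := vertex_inhabited G.
apply: (halfspaces_partial_cube hG bipG _ r).
move=> a b x y u v ab xy uv Wx Wu Wy Wv.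
by have [] := hF a b ab x y u v
  (ex_intro _ x (ex_intro _ y (And4 xy Wx Wy erefl)))
  (ex_intro _ u (ex_intro _ v (And4 uv Wu Wv erefl))) Wx Wu Wy Wv.
Qed.
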